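(* Let $k$ and $t$ be positive integers with $0<t<k-1$. Then the $\left(\binom{k}{t+1},\binom{k}{t},\binom{k}{t}-(t+1),k\right)$ PDA $\mathbf{P}_1$ is Pareto-optimal.
   Context: Write $[0,b)=\{0,1,\ldots,b-1\}$. For positive integers $K,F$, a $(K,F,S)$ placement delivery array (PDA) is an $F\times K$ array $\mathbf{P}=(p_{i,j})$, $i\in[0,F)$, $j\in[0,K)$, each of whose entries is either the symbol $*$ (''star'') or an integer from $[0,S)$, such that: whenever two distinct entries satisfy $p_{i_1,j_1}=p_{i_2,j_2}=s$ with $s$ an integer, then (a) $i_1\neq i_2$ and $j_1\neq j_2$, and (b) $p_{i_1,j_2}=p_{i_2,j_1}=*$. A $(K,F,Z,S)$ PDA (with $1\le Z\leq F$) is a $(K,F,S)$ PDA in which each column has exactly $Z$ stars. The rate of a $(K,F,Z,S)$ PDA is $R=S/F$, its packet number is $F$, and its memory ratio is $Z/F$. A $(K,F,Z,S)$ PDA is called Pareto-optimal if it achieves the tradeoff between $R$ and $F$ among PDAs with the same number of columns $K$ and the same memory ratio: for every $(K,F',Z',S')$ PDA with $Z'/F'=Z/F$, (i) if $F'<F$ then $S'/F'>S/F$, and (ii) if $S'/F'<S/F$ then $F'>F$. A PDA $\mathbf{P}_1$ with the stated parameters exists for all $0<t<k-1$; Pareto-optimality depends only on its parameters. *)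

(* Defs.v *)
From mathcomp Require Import all_boot all_order all_algebra.

Set Implicit Arguments.
Unset Strict Implicit.
Unset Printing Implicit Defensive.

Import Order.TTheory GRing.Theory Num.Theory.
Local Open Scope ring_scope.

(* An F x K array over {*} + [0, S): the star is [None], the integer s is
   [Some s]. *)
Definition pda_array (K F S : nat) := 'M[option 'I_S]_(F, K).

(* A symbol of [0, S) is not required to occur in the array. *)
Definition is_PDA (K F S : nat) (P : pda_array K F S) : Prop :=
  [/\ (0 < K)%N, (0 < F)%N &
      forall (i1 i2 : 'I_F) (j1 j2 : 'I_K) (s : 'I_S),
        (i1, j1) <> (i2, j2) -> P i1 j1 = Some s -> P i2 j2 = Some s ->
        (i1 <> i2 /\ j1 <> j2) /\ (P i1 j2 = None /\ P i2 j1 = None)].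

Definition is_PDA_with_stars (K F Z S : nat) (P : pda_array K F S) : Prop :=
  [/\ is_PDA P, (1 <= Z <= F)%N &
      forall j : 'I_K, #|[set i : 'I_F | P i j == None]| = Z].

Definition rate (F S : nat) : rat := S%:R / F%:R.

Definition memory_ratio (F Z : nat) : rat := Z%:R / F%:R.

Definition pareto_optimal (K F Z S : nat) (P : pda_array K F S) : Prop :=
  is_PDA_with_stars Z P /\
  forall (F' Z' S' : nat) (P' : pda_array K F' S'),
    is_PDA_with_stars Z' P' -> memory_ratio F' Z' = memory_ratio F Z ->
    ((F' < F)%N -> rate F S < rate F' S') /\
    (rate F' S' < rate F S -> (F < F')%N).

(* Main.v *)
(* If an entry of a PDA is an integer, then its row and its column share no
   other integer: an integer s at (i, j') and (i', j) would force a star at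
   (i, j).  Hence a row with m integers meeting a column with d integers gives
   S >= m + d - 1.  Averaging over the rows, some row has at least
   K d / F' = k - t integers, so S' >= k - t - 1 + d with d / F' = (t+1) / F;
   dividing by F' bounds the rate below by (k-t-1) / F' + (t+1) / F.
   For existence, index rows by t-subsets A and columns by (t+1)-subsets B,
   with s at (A, B) when B is the disjoint union of A and {s}. *)
Require Import Defs.
From mathcomp Require Import all_boot all_order all_algebra.
From mathcomp Require Import zify.

Set Implicit Arguments.
Unset Strict Implicit.
Unset Printing Implicit Defensive.

Import Order.TTheory GRing.Theory Num.Theory.

Lemma PDA_row_col_bound K F S (P : pda_array K F S) (i : 'I_F) (j : 'I_K) :
  is_PDA P -> P i j ->
  #|[set j' | P i j']| + #|[set i' | P i' j]| <= S.+1.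
Proof.
case=> _ _ PDA; case Pij: (P i j) => [s0|//] _.
pose r := fun j' : 'I_K => odflt s0 (P i j').
pose c := fun i' : 'I_F => odflt s0 (P i' j).
have injr : {in [set j' | P i j'] &, injective r}.
  move=> j1 j2; rewrite !inE /r.
  case P1: (P i j1) => [s1|//] _; case P2: (P i j2) => [s2|//] _ /= es.
  apply/eqP/negPn/negP => /eqP ne; rewrite -es in P2.
  have ne' : (i, j1) <> (i, j2) by case.
  by have [[]] := PDA _ _ _ _ _ ne' P1 P2.
have injc : {in [set i' | P i' j] &, injective c}.
  move=> i1 i2; rewrite !inE /c.
  case P1: (P i1 j) => [s1|//] _; case P2: (P i2 j) => [s2|//] _ /= es.
  apply/eqP/negPn/negP => /eqP ne; rewrite -es in P2.
  have ne' : (i1, j) <> (i2, j) by case.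
  by have [[]] := PDA _ _ _ _ _ ne' P1 P2.
(* The union of the two symbol sets has at most [S] elements and their intersection lies in the
   singleton of [s0], whence [S.+1]. *)
rewrite -(card_in_imset injr) -(card_in_imset injc) -cardsUI -addn1 leq_add //.
  by rewrite -[leqRHS]card_ord max_card.
rewrite -(cards1 s0); apply/subset_leq_card/subsetP => s.
rewrite !inE => /andP[/imsetP[j' + ->] /imsetP[i']].
rewrite !inE /r /c.
case P1: (P i j') => [s1|//] _; case P2: (P i' j) => [s2|//] _ /= es.
rewrite -es in P2.
have [ij|/eqP ne] := eqVneq (i, j') (i', j).
  by case: ij P1 => _ ->; rewrite Pij => -[->].
by have [_ [+ _]] := PDA _ _ _ _ _ ne P1 P2; rewrite Pij.
Qed.

Lemma exists_heavy_row K F S (P : pda_array K F S) d :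
  0 < F -> (forall j, #|[set i | P i j]| = d) ->
  exists i, K * d <= F * #|[set j | P i j]|.
Proof.
move=> F0 col; apply/existsP; rewrite -[X in is_true X]negbK negb_exists.
apply/negP => /forallP light.
have sumE : \sum_i #|[set j | P i j]| = K * d.
  rewrite -[in RHS](card_ord K) -sum_nat_const.
  rewrite [RHS](eq_bigr (fun j => \sum_(i | P i j) 1)); last first.
    by move=> j _; rewrite sum1dep_card col.
  rewrite (exchange_big_dep predT) //=.
  by apply: eq_bigr => i _; rewrite sum1dep_card.
(* With all rows light, the sum over the [F] rows would give [F * (K * d) + F <= F * (K * d)]. *)
suff : \sum_i (F * #|[set j | P i j]|).+1 <= \sum_(i < F) K * d.
  under eq_bigr => i _ do rewrite -addn1.
  rewrite big_split /= -big_distrr /= sumE !sum_nat_const card_ord; lia.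
by apply: leq_sum => i _; rewrite ltnNge light.
Qed.

(** Here [m] bounds from below the average number of integers per row. Since [m > 0], a heavy row
    contains an integer, and its column has [F - Z] of them. *)
Lemma PDA_symbols_lb K F Z S (P : pda_array K F S) m :
  is_PDA_with_stars Z P -> 0 < m -> F * m <= K * (F - Z) -> m + (F - Z) <= S.+1.
Proof.
move=> [PDA /andP[_ ZF] stars] m0 hm; have [K0 F0 _] := PDA.
have col j : #|[set i | P i j]| = F - Z.
  rewrite -(stars j) [LHS]cardsCs card_ord; congr (_ - _); apply: eq_card => i.
  by rewrite !inE; case: (P i j).
have [i hi] := @exists_heavy_row _ _ _ P _ F0 col.
have row : m <= #|[set j | P i j]|.
  by rewrite -(leq_pmul2l F0) (leq_trans hm).
have /card_gt0P[j] := leq_trans m0 row; rewrite inE => Pij.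
have := @PDA_row_col_bound _ _ _ P i j PDA Pij; rewrite col.
by apply: leq_trans; rewrite leq_add2r.
Qed.

(** Numbers the [t]-subsets, so that ordinals can index an array by them. *)
Lemma draws_enum k t : exists2 f : 'I_'C(k, t) -> {set 'I_k}, injective f &
  forall A : {set 'I_k}, #|A| = t <-> exists i, f i = A.
Proof.
have e : #|[set A : {set 'I_k} | #|A| == t]| = 'C(k, t).
  by rewrite card_draws card_ord.
rewrite -e; exists enum_val; first exact: enum_val_inj.
move=> A; split=> [/eqP At|[i <-]]; last first.
  by have := enum_valP i; rewrite inE => /eqP.
have At' : A \in [set A : {set 'I_k} | #|A| == t] by rewrite inE.
by exists (enum_rank_in At' A); rewrite enum_rankK_in.
Qed.

(** Monotonicity in [k] reduces this to [k = t + 2], where the binomial is [(t + 2)(t + 1) / 2]. It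
    makes the number of stars positive and the subtraction exact. *)
Lemma ltn_binS k t : 0 < t -> t.+1 < k -> t.+1 < 'C(k, t).
Proof.
move=> t0 tk; apply: (@leq_trans 'C(t.+2, t)); last exact: leq_bin2l.
have -> : 'C(t.+2, t) = 'C(t.+2, 2) by rewrite -(@bin_sub _ 2) // subn2.
rewrite -(@ltn_pmul2l 2) //; have := mul_bin_diag t.+2 1; rewrite bin1 /= => <-.
by rewrite ltn_mul2r.
Qed.

Lemma subset_PDA_exists k t : 0 < t -> t.+1 < k ->
  exists P : pda_array 'C(k, t.+1) 'C(k, t) k,
    is_PDA_with_stars ('C(k, t) - t.+1) P.
Proof.
move=> t0 tk.
have [f injf fP] := draws_enum k t; have [g injg gP] := draws_enum k t.+1.
pose P : pda_array 'C(k, t.+1) 'C(k, t) k :=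
  (\matrix_(i, j) [pick s | (s \in g j) && (f i == g j :\ s)])%R.
have PE i j s : P i j = Some s <-> s \in g j /\ f i = g j :\ s.
  rewrite mxE; split.
    by case: pickP => // x /andP[xg /eqP fx] [<-].
  (* The picked [x] must be [s]: it lies in [g j] but not in [f i = g j :\ s]. *)
  move=> [sg fs]; case: pickP => [x /andP[xg /eqP fx]|/(_ s)]; last first.
    by rewrite sg fs eqxx.
  congr Some; apply/eqP; have : x \notin f i by rewrite fx !inE eqxx.
  by rewrite fs !inE xg andbT negbK.
have tF := ltn_binS t0 tk.
exists P; split; [split | |]; try by rewrite bin_gt0; lia.
- move=> i1 i2 j1 j2 s ne /PE[s1 f1] /PE[s2 f2].
  have g1 : s |: f i1 = g j1 by rewrite f1 setD1K.
  have g2 : s |: f i2 = g j2 by rewrite f2 setD1K.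
  have ni : i1 <> i2.
    move=> ei; apply: ne; rewrite ei; congr pair.
    by apply: injg; rewrite -g1 -g2 ei.
  have nj : j1 <> j2.
    move=> ej; apply: ne; rewrite ej; congr pair.
    by apply: injf; rewrite f1 f2 ej.
  (* An integer [x] at [(i, j')] would give [f i = g j' :\ x]; as [s] is in [g j'] but not in [f i],
     this forces [x = s] and [f i = f i']. *)
  have cross i i' j j' : i <> i' -> f i = g j :\ s ->
      s \in g j' -> f i' = g j' :\ s -> P i j' = None.
    move=> nii fi sj' fi'; case Pij: (P i j') => [x|//].
    have [_ fx] := (PE i j' x).1 Pij.
    have : s \notin f i by rewrite fi !inE eqxx.
    rewrite fx !inE sj' andbT negbK => /eqP sx.
    by case: nii; apply: injf; rewrite fi' fx sx.
  by do 2 split=> //; [apply: (cross _ i2 j1) | apply: (cross _ i1 j2)] => //;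
    exact: nesym.
- by apply/andP; split; lia.
move=> j; have gj : #|g j| = t.+1 by apply/gP; exists j.
have -> : [set i | P i j == None] = ~: [set i | P i j].
  by apply/setP => i; rewrite !inE; case: (P i j).
rewrite cardsCs setCK card_ord; congr (_ - _).
(* The integer rows of column [j] correspond to the sets [g j :\ s] with [s] in [g j], which are
   pairwise distinct. *)
rewrite -(card_imset _ injf); apply: (etrans _ gj).
rewrite -[RHS](@card_in_imset _ _ (fun s => g j :\ s)).
  apply: eq_card => A; apply/imsetP/imsetP => [[i]|[s sg ->]].
    rewrite inE; case Pij: (P i j) => [s|//] _ ->.
    by have [sg fs] := (PE i j s).1 Pij; exists s.
  have [|i fi] := (fP (g j :\ s)).1.
    by move: (cardsD1 s (g j)); rewrite sg gj; lia.
  by exists i => //; rewrite inE ((PE i j s).2 _).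
move=> s s' sg sg' /setP/(_ s); rewrite !inE eqxx sg /= andbT.
by move/esym/negbFE/eqP.
Qed.

Lemma nat_frac_lt (a b c d : nat) : 0 < b -> 0 < d ->
  ((a%:R / b%:R : rat) < c%:R / d%:R)%R = (a * d < c * b).
Proof.
move=> b0 d0; rewrite ltr_pdivrMr ?ltr0n // mulrAC ltr_pdivlMr ?ltr0n //.
by rewrite -!natrM ltr_nat.
Qed.

Lemma nat_frac_eq (a b c d : nat) : 0 < b -> 0 < d ->
  (a%:R / b%:R = c%:R / d%:R :> rat)%R -> a * d = c * b.
Proof.
move=> b0 d0 /eqP; rewrite eqr_div ?pnatr_eq0 -?lt0n //.
by rewrite -!natrM eqr_nat => /eqP.
Qed.

Theorem theorem9 (k t : nat) (ht0 : 0 < t) (htk : t < k - 1) :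
  (exists P1 : pda_array 'C(k, t.+1) 'C(k, t) k,
     is_PDA_with_stars ('C(k, t) - t.+1) P1) /\
  (forall P1 : pda_array 'C(k, t.+1) 'C(k, t) k,
     is_PDA_with_stars ('C(k, t) - t.+1) P1 ->
     pareto_optimal ('C(k, t) - t.+1) P1).
Proof.
have tk : t.+1 < k by lia.
split; first exact: subset_PDA_exists.
move=> P1 hP1; split=> // F' Z' S' P' hP'.
have tF := ltn_binS ht0 tk; have [[_ F'0 _] /andP[_ ZF'] _] := hP'.
(* Double counting of integers in [P1]: [t.+1] per column, [k - t] per row on average. *)
have KF := mul_bin_left k t.
rewrite /memory_ratio /rate; set F := 'C(k, t) in tF KF *.
have F0 : 0 < F by lia.
move=> /(nat_frac_eq F'0 F0) ratio; rewrite !nat_frac_lt //.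
have dF : (F' - Z') * F = t.+1 * F' by nia.
have bound : (k - t) + (F' - Z') <= S'.+1.
  apply: (PDA_symbols_lb hP'); first by lia.
  (* After multiplication by [F], both sides agree by [dF] and [KF]. *)
  rewrite -(leq_pmul2r F0) -mulnA [leqRHS]mulnAC -mulnA; nia.
have key : (k - t).-1 * F + t.+1 * F' <= S' * F by rewrite -dF; nia.
have c0 : 0 < (k - t).-1 by lia.
(* The terms [t.+1 * F'] now cancel against [key], and both clauses reduce to comparing [F] with
   [F'], scaled by the positive [(k - t).-1]. *)
have -> : k * F' = (k - t).-1 * F' + t.+1 * F' by rewrite -mulnDl; congr muln; lia.
split=> [lt_F'F | ].
  by apply: leq_trans key; rewrite ltn_add2r ltn_pmul2l.
by move=> /(leq_ltn_trans key); rewrite ltn_add2r ltn_pmul2l.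
Qed.
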